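(* Let $\vec v=(y_1,\dots,y_n)^T\in\mathbb{R}_+^n$ be a basis of the number field $\mathbb{Q}(y_1)$ (as a vector space over $\mathbb{Q}$), and suppose $\vec v$ has an eventually periodic expansion in a unimodular Jacobi--Perron type MCF algorithm. Let $M$ be a matrix of repetend of this expansion. Then \[ M=(T_\varepsilon^{\vec v})^T \] for some unit $\varepsilon\in U(\mathcal{O}_{\mathbb{Q}(y_1)})$, where $T_\varepsilon^{\vec v}$ is the matrix of the $\mathbb{Q}$-linear map $x\mapsto\varepsilon x$ on $\mathbb{Q}(y_1)$ in the basis $\vec v$.
   Context: $\mathbb{R}_+$ denotes the positive reals; $\mathcal{O}_K$ is the ring of integers of $K$ and $U(\mathcal O_K)$ its unit group. The matrix of a linear map in the basis $\vec v$ has as $i$-th column the coordinate vector of the image of $v_i$. A Jacobi--Perron type MCF algorithm is given by an at most countable family $\mathcal I=\{I_1,I_2,\dots\}$ of pairwise disjoint subsets of $\mathbb{R}_+^n$ with $\alpha I\subseteq I$ for all $\alpha>0$, $I\in\mathcal I$, and a family $\mathcal A=\{A_1,A_2,\dots\}$ (same index set) of invertible real $n\times n$ matrices such that no product of matrices from $\mathcal A$ equals the identity. Given $\vec v\in\mathbb{R}_+^n$, set $\vec v^{(0)}=\vec v$; at step $i$, if $\vec v^{(i)}\in I_j$ set $A^{(i)}=A_j$ and $\vec v^{(i+1)}=A_j^{-1}\vec v^{(i)}$ (if $\vec v^{(i)}$ lies in no $I_j$, stop). The sequence $(A^{(i)})$ is the expansion of $\vec v$. The algorithm is unimodular if all matrices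 of $\mathcal A$ are integer matrices with determinant $\pm1$. The expansion is eventually periodic if there exist $N\ge0$, $p\ge1$ and real $\lambda$ with $\vec v^{(N)}=\lambda\vec v^{(N+p)}$; then, with $R=A^{(0)}\cdots A^{(N-1)}$ and $P=A^{(N)}\cdots A^{(N+p-1)}$, the matrix $RPR^{-1}$ is called a matrix of repetend. *)

(* Defs.v *)
From HB Require Import structures.
From mathcomp Require Import all_boot all_order all_algebra.
From mathcomp Require Import boolp classical_sets reals.

Set Implicit Arguments.
Unset Strict Implicit.
Unset Printing Implicit Defensive.

Import Order.TTheory GRing.Theory Num.Theory.
Local Open Scope classical_set_scope.
Local Open Scope ring_scope.

Section NumberField.
Variable R : realType.

(* Q(y): the intersection of all subfields of R containing y. *)
Definition Qadjoin (y : R) : set R :=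
  [set x | forall S : {pred R}, divring_closed S -> y \in S -> x \in S].

Definition ring_of_integers (K : set R) : set R :=
  [set x | K x /\ integralOver (intr : int -> R) x].

Definition unit_group (O : set R) : set R :=
  [set x | O x /\ exists2 y, O y & x * y = 1].

Definition is_coord n (v : 'cV[R]_n) (x : R) (c : 'cV[rat]_n) : Prop :=
  x = \sum_k ratr (c k 0) * v k 0.

Definition Qbasis n (K : set R) (v : 'cV[R]_n) : Prop :=
  [/\ forall i, K (v i 0),
      forall c, is_coord v 0 c -> c = 0
    & forall x, K x -> exists c, is_coord v x c].

(* T is the matrix of f in the basis v, with images as columns; it is unique
   as soon as v is linearly independent over Q. *)
Definition is_mx_in_basis n (v : 'cV[R]_n) (f : R -> R) (T : 'M[rat]_n) : Prop :=
  forall i, is_coord v (f (v i 0)) (col i T).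

End NumberField.

Section MCF.
Variables (R : realType) (n : nat).

Definition posvec (v : 'cV[R]_n) : Prop := forall i, 0 < v i 0.

Record mcf := Mcf {
  mcf_index : countType;
  mcf_cone : mcf_index -> set 'cV[R]_n;
  mcf_mx : mcf_index -> 'M[R]_n;
  mcf_cone_pos : forall j v, mcf_cone j v -> posvec v;
  mcf_cone_disj : forall i j, i != j -> mcf_cone i `&` mcf_cone j = set0;
  mcf_coneZ : forall j (a : R) v, 0 < a -> mcf_cone j v -> mcf_cone j (a *: v);
  mcf_mx_unit : forall j, mcf_mx j \in unitmx;
  (* the empty product is excluded *)
  mcf_mx_prod : forall s : seq mcf_index,
    s != [::] -> \prod_(j <- s) mcf_mx j <> 1%:M
}.

Definition unimodular (alg : mcf) : Prop :=
  forall j : mcf_index alg, mcf_mx j \is a mxOver Num.int /\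
    (\det (mcf_mx j) = 1 \/ \det (mcf_mx j) = -1).

(* The algorithm performs at least m steps on v; w 0, ..., w m are the
   successive vectors v^(i) and A 0, ..., A m.-1 the matrices A^(i). Values of w
   and A at larger indices are irrelevant. *)
Definition mcf_run (alg : mcf) (v : 'cV[R]_n) (m : nat)
    (w : nat -> 'cV[R]_n) (A : nat -> 'M[R]_n) : Prop :=
  w 0%N = v /\
  forall i, (i < m)%N -> exists j : mcf_index alg,
    [/\ mcf_cone j (w i), A i = mcf_mx j & w i.+1 = invmx (A i) *m w i].

(* The expansion of v has preperiod N and period p. *)
Definition mcf_periodic (alg : mcf) (v : 'cV[R]_n) (N p : nat)
    (w : nat -> 'cV[R]_n) (A : nat -> 'M[R]_n) : Prop :=
  [/\ (0 < p)%N, mcf_run alg v (N + p) w A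
    & exists lambda : R, w N = lambda *: w (N + p)%N].

Definition eventually_periodic (alg : mcf) (v : 'cV[R]_n) : Prop :=
  exists N p w A, mcf_periodic alg v N p w A.

Definition matrix_of_repetend (alg : mcf) (v : 'cV[R]_n) (M : 'M[R]_n) : Prop :=
  exists N p w A, mcf_periodic alg v N p w A /\
    let Rm := \prod_(0 <= i < N) A i in
    let Pm := \prod_(N <= i < N + p) A i in
    M = Rm *m Pm *m invmx Rm.

End MCF.

(* Main.v *)
Require Import Defs.
From HB Require Import structures.
From mathcomp Require Import all_boot all_order all_algebra.
From mathcomp Require Import boolp classical_sets reals.

Set Implicit Arguments.
Unset Strict Implicit.
Unset Printing Implicit Defensive.

Import Order.TTheory GRing.Theory Num.Theory.
Local Open Scope ring_scope.

(** If v^(N) = lambda v^(N+p), then v = R v^(N) = R P v^(N+p), so M = R P R^-1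
    satisfies M v = lambda v, which says that M^T is the matrix of
    multiplication by lambda in the basis v. Comparing one nonzero coordinate of
    both sides puts lambda in the field of the coordinates of v, and since M
    lies in GL_n(Z), lambda is a root of the characteristic polynomial of an
    integer matrix. Both arguments apply to lambda^-1, because
    M^-1 v = lambda^-1 v. *)

Section InvertibleMatrixOverSubring.
Context {R : comUnitRingType} {n : nat}.

Lemma unitmx_mulr_closed : mulr_closed (@unitmx R n).
Proof. by split=> [|A B uA uB]; rewrite ?unitmx1 // unitmx_mul uA. Qed.

HB.instance Definition _ :=
  GRing.isMulClosed.Build 'M[R]_n (@unitmx R n) unitmx_mulr_closed.

Lemma invmxM (A B : 'M[R]_n) :
  A \in unitmx -> B \in unitmx -> invmx (A *m B) = invmx B *m invmx A.
Proof.
move=> uA uB; have uAB : A *m B \in unitmx by rewrite unitmx_mul uA.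
by apply: (can_inj (mulKmx uAB)); rewrite mulmxV // -mulmxA mulKVmx // mulmxV.
Qed.

Lemma mxOver_det (S : subringClosed R) m :
  {in mxOver S, forall A : 'M[R]_m, \det A \in S}.
Proof.
move=> A /mxOverP SA; apply: rpred_sum => s _.
by rewrite rpredMsign rpred_prod.
Qed.

Lemma mxOver_adj (S : subringClosed R) :
  {in mxOver S, forall A : 'M[R]_n, \adj A \is a mxOver S}.
Proof.
move=> A /mxOverP SA; apply/mxOverP => i j; rewrite mxE rpredMsign.
by apply: mxOver_det; apply/mxOverP => k l; rewrite !mxE.
Qed.

Definition unitmxOver (S : {pred R}) : {pred 'M[R]_n} :=
  [pred A | [&& A \in unitmx, A \is a mxOver S & invmx A \is a mxOver S]].

Lemma unitmxOver_mulr_closed (S : semiringClosed R) :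
  mulr_closed (unitmxOver S).
Proof.
split=> [|A B /and3P[uA SA SVA] /and3P[uB SB SVB]]; apply/and3P.
  by rewrite invmx1 unitmx1; split; rewrite ?mxOver_scalar ?rpred0 ?rpred1.
by split; rewrite ?rpredM // invmxM // mxOverM.
Qed.

HB.instance Definition _ (S : semiringClosed R) :=
  GRing.isMulClosed.Build 'M[R]_n (unitmxOver S) (unitmxOver_mulr_closed S).

Lemma unitmxOverV (S : {pred R}) :
  {in unitmxOver S, forall A, invmx A \in unitmxOver S}.
Proof. by move=> A /and3P[uA SA SVA]; rewrite inE unitmx_inv invmxK uA SVA. Qed.

Lemma unitmxOver_det (S : subringClosed R) (A : 'M[R]_n) :
  A \is a mxOver S -> \det A \is a GRing.unit -> (\det A)^-1 \in S ->
  A \in unitmxOver S.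
Proof.
move=> SA uA SVdet; have {}uA : A \in unitmx by rewrite unitmxE.
by rewrite inE uA SA /invmx uA mxOverZ // mxOver_adj.
Qed.

End InvertibleMatrixOverSubring.

Lemma mxOver_intP (R : archiNumDomainType) m n (A : 'M[R]_(m, n)) :
  reflect (exists B : 'M[int]_(m, n), A = map_mx intr B)
          (A \is a mxOver Num.int).
Proof.
apply: (iffP mxOverP) => [intA | [B ->] i j]; last by rewrite mxE.
exists (map_mx Num.floor A).
by apply/matrixP => i j; rewrite !mxE floorK.
Qed.

Section Eigenvalues.
Variables (F : fieldType) (n : nat).
Implicit Types (A : 'M[F]_n) (x : 'cV[F]_n) (l : F).

Lemma invmx_eigenvector A x l :
  A \in unitmx -> A *m x = l *: x -> invmx A *m x = l^-1 *: x.
Proof.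
move=> uA Ax; have [l_eq0 | l_neq0] := eqVneq l 0.
  by rewrite -(mulKmx uA x) Ax l_eq0 scale0r !mulmx0 scaler0.
by rewrite -{1}(scalerK l_neq0 x) -scalemxAr -Ax mulKmx.
Qed.

Lemma unitmx_eigenvalue_neq0 A x l :
  A \in unitmx -> x != 0 -> A *m x = l *: x -> l != 0.
Proof.
move=> uA x_neq0 Ax; apply: contraNneq x_neq0 => l_eq0.
by rewrite -(mulKmx uA x) Ax l_eq0 scale0r mulmx0.
Qed.

Lemma mxOver_eigenvalue (S : divringClosed F) A x l :
  A \is a mxOver S -> x \is a mxOver S -> x != 0 -> A *m x = l *: x -> l \in S.
Proof.
move=> SA Sx /matrix0Pn[i [j xij]] Ax.
rewrite -(mulfK xij l) rpred_div ?(mxOverP Sx) //.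
have -> : l * x i j = (A *m x) i j by rewrite Ax mxE.
exact: (mxOverP (mxOverM SA Sx)).
Qed.

Lemma integralOver_eigenvalue (D : comNzRingType) (f : {rmorphism D -> F})
    (B : 'M[D]_n) x l :
  x != 0 -> map_mx f B *m x = l *: x -> integralOver f l.
Proof.
move=> x_neq0 Bx; exists (char_poly B^T); first exact: char_poly_monic.
rewrite map_char_poly -eigenvalue_root_char; apply/eigenvalueP.
exists x^T; last by rewrite -trmx0 (inj_eq trmx_inj).
by rewrite -map_trmx -trmx_mul Bx linearZ.
Qed.

End Eigenvalues.

Section AlgebraicUnits.
Variables (R : realType) (y : R).

Definition Qadjoin_pred : {pred R} := fun x => `[< Qadjoin y x >].

Lemma Qadjoin_divring_closed : divring_closed Qadjoin_pred.
Proof.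
split=> [|a b /asboolP Ka /asboolP Kb|a b /asboolP Ka /asboolP Kb];
  apply/asboolP => S divS yS; have [S1 SB Sdiv] := divS => //.
  by apply: SB; [apply: Ka | apply: Kb].
by apply: Sdiv; [apply: Ka | apply: Kb].
Qed.

HB.instance Definition _ :=
  GRing.isDivringClosed.Build R Qadjoin_pred Qadjoin_divring_closed.

Variables (n : nat) (v : 'cV[R]_n).
Hypotheses (Kv : forall i, Qadjoin y (v i 0)) (v_neq0 : v != 0).

Lemma ring_of_integers_eigenvalue (A : 'M[R]_n) (l : R) :
  A \is a mxOver Num.int -> A *m v = l *: v ->
  ring_of_integers (Qadjoin y) l.
Proof.
move=> intA Av; split.
  apply/asboolP; apply: (mxOver_eigenvalue (S := Qadjoin_pred)) v_neq0 Av.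
    by apply: mxOverS intA => _ /intrP[m ->]; apply: rpred_int.
  by apply/mxOverP => i j; rewrite ord1; apply/asboolP.
have /mxOver_intP[B AB] := intA.
by move: Av; rewrite AB; apply: integralOver_eigenvalue.
Qed.

Lemma unit_group_eigenvalue (A : 'M[R]_n) (l : R) :
  A \in unitmxOver Num.int -> A *m v = l *: v ->
  unit_group (ring_of_integers (Qadjoin y)) l.
Proof.
move=> /and3P[uA intA intVA] Av; split.
  exact: ring_of_integers_eigenvalue Av.
exists l^-1; last by rewrite divff // (unitmx_eigenvalue_neq0 uA v_neq0 Av).
by apply: ring_of_integers_eigenvalue intVA _; apply: invmx_eigenvector.
Qed.

End AlgebraicUnits.

Lemma is_mx_in_basis_mulP (R : realType) n (v : 'cV[R]_n) (l : R)
    (T : 'M[rat]_n) :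
  is_mx_in_basis v (fun x => l * x) T <-> (map_mx ratr T)^T *m v = l *: v.
Proof.
have coordE i : \sum_k ratr (col i T k 0) * v k 0
    = ((map_mx ratr T)^T *m v) i 0.
  by rewrite mxE; apply: eq_bigr => k _; rewrite !mxE.
split=> [Tl | Tl i]; last by rewrite /is_coord coordE Tl mxE.
by apply/colP => i; rewrite -coordE -Tl mxE.
Qed.

Section Repetend.
Variables (R : realType) (n : nat) (alg : mcf R n) (v : 'cV[R]_n).

Lemma rpred_mcf_run_prod (S : mulrClosed 'M[R]_n) m w A a b :
  (forall j : mcf_index alg, mcf_mx j \in S) ->
  mcf_run alg v m w A -> (b <= m)%N -> \prod_(a <= i < b) A i \in S.
Proof.
move=> SA [_ step] bm; rewrite big_nat; apply: rpred_prod => i /andP[_ ib].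
by have [j [_ -> _]] := step i (leq_trans ib bm).
Qed.

Lemma mcf_run_prod m w A a b :
  mcf_run alg v m w A -> (a <= b <= m)%N ->
  w a = \prod_(a <= i < b) A i *m w b.
Proof.
case=> _ step; elim: b => [|b IHb] /andP[].
  by rewrite leqn0 => /eqP -> _; rewrite big_geq // mul1mx.
rewrite leq_eqVlt => /predU1P[-> _ | ab bm]; first by rewrite big_geq ?mul1mx.
have [j [_ Ab ->]] := step b bm.
rewrite big_nat_recr //= -mulmxA mulKVmx ?Ab ?mcf_mx_unit // -?Ab.
by apply: IHb; rewrite -ltnS ab ltnW.
Qed.

Lemma matrix_of_repetend_eigenvector M :
  matrix_of_repetend alg v M -> exists l : R, M *m v = l *: v.
Proof.
case=> N [p [w [A [[_ run [l wN]] /= ->]]]]; exists l.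
have uR : \prod_(0 <= i < N) A i \in unitmx.
  by apply: rpred_mcf_run_prod run (leq_addr _ _); apply: mcf_mx_unit.
have vE : v = \prod_(0 <= i < N) A i *m w N.
  by case: (run) => <- _; apply: mcf_run_prod run _; rewrite leq_addr.
have wE : w N = \prod_(N <= i < N + p) A i *m w (N + p)%N.
  by apply: mcf_run_prod run _; rewrite leq_addr leqnn.
by rewrite {1}vE -!mulmxA (mulKmx uR) wN -!scalemxAr -wE -vE.
Qed.

Lemma matrix_of_repetend_unitmxOver (S : semiringClosed R) M :
  (forall j : mcf_index alg, mcf_mx j \in unitmxOver S) ->
  matrix_of_repetend alg v M -> M \in unitmxOver S.
Proof.
move=> SA [N [p [w [A [[_ run _] /= ->]]]]].
have SR : \prod_(0 <= i < N) A i \in unitmxOver S.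
  exact: rpred_mcf_run_prod run (leq_addr _ _).
have SP : \prod_(N <= i < N + p) A i \in unitmxOver S.
  exact: rpred_mcf_run_prod run (leqnn _).
by rewrite !rpredM // unitmxOverV.
Qed.

Lemma unimodular_unitmxOver :
  unimodular alg -> forall j : mcf_index alg, mcf_mx j \in unitmxOver Num.int.
Proof.
move=> uni j; have [intA detA] := uni j.
by apply: unitmxOver_det => //; case: detA => ->;
  rewrite ?invrN1 ?invr1 ?rpredN ?unitrN ?rpred1 ?unitr1.
Qed.

End Repetend.

Theorem theorem4p2 (R : realType) (n : nat) (v : 'cV[R]_n.+1)
    (alg : mcf R n.+1) (M : 'M[R]_n.+1) :
  posvec v ->
  Qbasis (Qadjoin (v ord0 0)) v ->
  unimodular alg ->
  eventually_periodic alg v ->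
  matrix_of_repetend alg v M ->
  exists2 eps : R,
    unit_group (ring_of_integers (Qadjoin (v ord0 0))) eps &
    exists2 T : 'M[rat]_n.+1,
      is_mx_in_basis v (fun x => eps * x) T &
      M = (map_mx ratr T)^T.
Proof.
move=> posv [Kv _ _] uni _ repM.
have v_neq0 : v != 0.
  by apply/matrix0Pn; exists ord0, 0; rewrite gt_eqF.
have [eps Mv] := matrix_of_repetend_eigenvector repM.
have GLM := matrix_of_repetend_unitmxOver (unimodular_unitmxOver uni) repM.
exists eps; first exact: (unit_group_eigenvalue Kv v_neq0 GLM Mv).
have /and3P[_ /mxOver_intP[B MB] _] := GLM.
have MT : M = (map_mx ratr (map_mx intr B)^T)^T.
  by apply/matrixP => i j; rewrite MB !mxE ratr_int.
by exists (map_mx intr B)^T => //; apply/is_mx_in_basis_mulP; rewrite -MT.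
Qed.
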